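(* The Riemann solver $\mathcal{RS}_3$ does not, in general, satisfy the entropy inequality $\mathcal F(\mathcal{RS}_3(\rho_{1,0},\dots,\rho_{2n,0}),k)\ge0$ for every initial datum $(\rho_{1,0},\dots,\rho_{2n,0})\in[0,1]^{2n}$ and every $k\in[0,1]$, nor the weaker requirement that $\mathcal F(\mathcal{RS}_3(\rho_{1,0},\dots,\rho_{2n,0}),\sigma)\ge0$ for every initial datum $(\rho_{1,0},\dots,\rho_{2n,0})\in[0,1]^{2n}$. That is, there exist an integer $n=m\ge1$, an admissible flux $f$, a coefficient $\Gamma_J>0$ and $\boldsymbol\theta\in\Theta$ such that the corresponding Riemann solver $\mathcal{RS}_3$ satisfies neither of these two requirements.
   Context: Admissible flux: $f:[0,1]\to\mathbb R$ continuous, piecewise smooth, concave, with $f(0)=f(1)=0$, and such that there is a unique $\sigma\in\,]0,1[$ with $f$ strictly increasing on $[0,\sigma[$ and strictly decreasing on $]\sigma,1]$. Convention: $\mathrm{sgn}(0)=0$. The node has $n$ incoming arcs (indices $1,\dots,n$) and $m=n$ outgoing arcs (indices $n+1,\dots,2n$). Entropy conditions: let $\mathcal F(\rho_1,\dots,\rho_{2n},k)=\sum_{i=1}^n\mathrm{sgn}(\rho_i-k)(f(\rho_i)-f(k))-\sum_{j=n+1}^{2n}\mathrm{sgn}(\rho_j-k)(f(\rho_j)-f(k))$. A Riemann solver $\mathcal{RS}:[0,1]^{2n}\to[0,1]^{2n}$ satisfies (E1) if $\mathcal F(\mathcal{RS}(\rho_{1,0},\dots,\rho_{2n,0}),k)\ge0$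 for every initial datum in $[0,1]^{2n}$ and every $k\in[0,1]$; it satisfies (E2) if $\mathcal F(\mathcal{RS}(\rho_{1,0},\dots,\rho_{2n,0}),\sigma)\ge0$ for every initial datum. $\Theta$ is the set of $\boldsymbol\theta=(\theta_1,\dots,\theta_{2n})\in\mathbb R^{2n}$ with all $\theta_l>0$ and $\sum_{i=1}^n\theta_i=\sum_{j=n+1}^{2n}\theta_j=1$. Sets of fluxes for an initial datum $(\rho_{1,0},\dots,\rho_{2n,0})$: for $i\le n$, $\Omega_i=[0,f(\rho_{i,0})]$ if $\rho_{i,0}\le\sigma$ and $\Omega_i=[0,f(\sigma)]$ if $\rho_{i,0}\ge\sigma$; for $j\ge n+1$, $\Omega_j=[0,f(\sigma)]$ if $\rho_{j,0}\le\sigma$ and $\Omega_j=[0,f(\rho_{j,0})]$ if $\rho_{j,0}\ge\sigma$. The solver $\mathcal{RS}_3$ (for fixed $\Gamma_J>0$, the maximum capacity of the node, and $\boldsymbol\theta\in\Theta$): for $i\le n$ let $\Gamma_i=\min\{\sup\Omega_i,\sup\Omega_{i+n}\}$ and $\Gamma=\sum_{i=1}^n\Gamma_i$. Let $I=\{(\gamma_1,\dots,\gamma_n)\in\prod_{i=1}^n[0,\Gamma_i]:\sum_{i=1}^n\gamma_i=\min\{\Gamma,\Gamma_J\}\}$. Let $(\bar\gamma_1,\dots,\bar\gamma_n)$ be the orthogonal projection of $(\min\{\Gamma,\Gamma_J\}\theta_1,\dots,\min\{\Gamma,\Gamma_J\}\theta_n)$ on the closed convex set $I$, and $(\bar\gamma_{n+1},\dots,\bar\gamma_{2n})=(\bar\gamma_1,\dots,\bar\gamma_n)$.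 For $i\le n$, $\bar\rho_i=\rho_{i,0}$ if $f(\rho_{i,0})=\bar\gamma_i$, otherwise $\bar\rho_i$ is the solution of $f(\rho)=\bar\gamma_i$ with $\rho\ge\sigma$; for $j\ge n+1$, $\bar\rho_j=\rho_{j,0}$ if $f(\rho_{j,0})=\bar\gamma_j$, otherwise $\bar\rho_j$ is the solution of $f(\rho)=\bar\gamma_j$ with $\rho\le\sigma$. Then $\mathcal{RS}_3(\rho_{1,0},\dots,\rho_{2n,0})=(\bar\rho_1,\dots,\bar\rho_{2n})$. *)

(* Defs.v *)
From HB Require Import structures.
From mathcomp Require Import all_boot all_order all_algebra.
From mathcomp Require Import all_classical all_reals all_analysis.

Set Implicit Arguments.
Unset Strict Implicit.
Unset Printing Implicit Defensive.

Import Order.TTheory GRing.Theory Num.Theory.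
Import numFieldNormedType.Exports.

Local Open Scope classical_set_scope.
Local Open Scope ring_scope.

(* A flux [0, 1] -> R is given by a total function R -> R of which only the
   values on [0, 1] are constrained and used. *)
Section Flux.
Context {R : realType}.
Implicit Types (f g : R -> R) (s : R).

Definition smooth g : Prop := forall (k : nat) (x : R), derivable (derive1n k g) x 1.

(* On each closed piece of some finite subdivision 0 = t_0 < ... < t_N = 1
   (with N = size t), f is the restriction of a C^oo function on R. *)
Definition piecewise_smooth01 f : Prop :=
  exists t : seq R,
    [/\ path <%R 0 t, last 0 t = 1 &
        forall i : nat, (i < size t)%N ->
          exists2 g, smooth g &
            {in `[nth 0 (0 :: t) i, nth 0 t i], f =1 g}].

Definition concave01 f : Prop :=
  @convex_function R R^o `[0, 1]%classic (fun x => - f x).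

Definition flux_peak f s : Prop :=
  [/\ 0 < s < 1,
      {in `[0, s[ &, {homo f : x y / x < y}} &
      {in `]s, 1] &, {homo f : x y / x < y >-> y < x}}].

Definition admissible_flux f s : Prop :=
  [/\ {within `[0, 1]%classic, continuous f},
      piecewise_smooth01 f,
      concave01 f,
      f 0 = 0 /\ f 1 = 0 &
      unique (flux_peak f) s].

End Flux.

(* A state of the node is a row vector of length n + n: the incoming arc i is
   the coordinate lshift n i, and its outgoing partner i + n is rshift n i. *)
Section Node.
Context {R : realType} {n : nat}.
Implicit Types (f : R -> R) (s k GammaJ : R).
Implicit Types (rho theta : 'rV[R]_(n + n)) (RS : 'rV[R]_(n + n) -> 'rV[R]_(n + n)).

Definition density rho : Prop := forall l, 0 <= rho 0 l <= 1.

Definition entropy_flux f rho k : R :=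
  \sum_(i < n) Num.sg (rho 0 (lshift n i) - k) * (f (rho 0 (lshift n i)) - f k)
  - \sum_(j < n) Num.sg (rho 0 (rshift n j) - k) * (f (rho 0 (rshift n j)) - f k).

Definition E1 f RS : Prop :=
  forall rho0, density rho0 -> forall k, 0 <= k <= 1 ->
    0 <= entropy_flux f (RS rho0) k.

Definition E2 f s RS : Prop :=
  forall rho0, density rho0 -> 0 <= entropy_flux f (RS rho0) s.

Definition Theta : set 'rV[R]_(n + n) :=
  [set theta | [/\ forall l, 0 < theta 0 l,
                   \sum_(i < n) theta 0 (lshift n i) = 1 &
                   \sum_(j < n) theta 0 (rshift n j) = 1]].

Definition Omega_in f s (r : R) : set R :=
  if r <= s then `[0, f r]%classic else `[0, f s]%classic.

Definition Omega_out f s (r : R) : set R :=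
  if r <= s then `[0, f s]%classic else `[0, f r]%classic.

Definition Omega f s rho0 (l : 'I_(n + n)) : set R :=
  match fintype.split l with
  | inl _ => Omega_in f s (rho0 0 l)
  | inr _ => Omega_out f s (rho0 0 l)
  end.

Definition Gamma_arc f s rho0 (i : 'I_n) : R :=
  Num.min (sup (Omega f s rho0 (lshift n i))) (sup (Omega f s rho0 (rshift n i))).

Definition Gamma_node f s GammaJ rho0 : R :=
  Num.min (\sum_(i < n) Gamma_arc f s rho0 i) GammaJ.

Definition flux_set f s GammaJ rho0 : set 'rV[R]_n :=
  [set g | (forall i, 0 <= g 0 i <= Gamma_arc f s rho0 i) /\
           \sum_(i < n) g 0 i = Gamma_node f s GammaJ rho0].

(* The norm of the library on 'rV[R]_n is the sup norm. *)
Definition euclidean_dist (u v : 'rV[R]_n) : R :=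
  Num.sqrt (\sum_(i < n) (u 0 i - v 0 i) ^+ 2).

(* The default value 0 of xget is irrelevant when A is nonempty, closed and
   convex: the nearest point then exists and is unique. *)
Definition orthogonal_projection (A : set 'rV[R]_n) (u : 'rV[R]_n) : 'rV[R]_n :=
  xget 0 [set v | A v /\ forall w, A w -> euclidean_dist u v <= euclidean_dist u w].

Definition RS3_flux f s GammaJ theta rho0 : 'rV[R]_n :=
  orthogonal_projection (flux_set f s GammaJ rho0)
    (\row_(i < n) (Gamma_node f s GammaJ rho0 * theta 0 (lshift n i))).

(* The default value s of xget in the next two definitions is irrelevant: for
   an admissible flux and 0 <= g <= f s, the equation f r = g has exactly one
   solution on each side of s. *)
Definition density_in f s (r0 g : R) : R :=
  if f r0 == g then r0 else xget s [set r | s <= r <= 1 /\ f r = g].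

Definition density_out f s (r0 g : R) : R :=
  if f r0 == g then r0 else xget s [set r | 0 <= r <= s /\ f r = g].

Definition RS3 f s GammaJ theta rho0 : 'rV[R]_(n + n) :=
  \row_(l < n + n)
    match fintype.split l with
    | inl i => density_in f s (rho0 0 l) (RS3_flux f s GammaJ theta rho0 0 i)
    | inr i => density_out f s (rho0 0 l) (RS3_flux f s GammaJ theta rho0 0 i)
    end.

End Node.

(* Main.v *)
Require Import Defs.
From mathcomp Require Import all_boot all_order all_algebra.
From mathcomp Require Import all_classical all_reals all_analysis.
From mathcomp Require Import ring lra.

(** The failure has nothing to do with a special flux or a special choice of
    coefficients: it comes from the capacity bound of the node.  Let every arc
    start at the critical density [sigma], so that each arc can carry the
    maximal flux [f sigma], and let the node let through a total flux
    [GammaJ < f sigma] only.  Then the target [GammaJ * theta] lies in the set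
    of feasible fluxes, hence is its own projection ([RS3_flux_critical]), and
    every arc gets a flux strictly below [f sigma].  Such a flux forces a
    traffic jam upstream, with density above [sigma]
    ([density_in_critical]), and an underloaded road downstream, with density
    below [sigma] ([density_out_critical]).  With these signs, each incoming
    and each outgoing arc adds the same negative quantity,
    its flux minus [f sigma], to the entropy flux at [k = sigma]
    ([RS3_critical_entropy_lt0]).  So the weaker requirement fails already,
    and with it the stronger one.

    The witness is the flux [x * (1 - x)] with one incoming and one outgoing
    arc, and half the maximal flux as capacity. *)

Import Order.TTheory GRing.Theory Num.Theory.
Import numFieldNormedType.Exports.

Local Open Scope classical_set_scope.
Local Open Scope ring_scope.

(** * The solver at the critical datum *)

Lemma orthogonal_projection_id (R : realType) (n : nat)
    (A : set 'rV[R]_n) (u : 'rV[R]_n) :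
  A u -> orthogonal_projection A u = u.
Proof.
move=> Au; rewrite /orthogonal_projection.
have dist0 : euclidean_dist u u = 0.
  rewrite /euclidean_dist big1 ?sqrtr0// => i _.
  by rewrite subrr expr0n.
case: xgetP => [v _ [_ /(_ u Au)]|/(_ u)[]]; last first.
  by split=> // w _; rewrite dist0 sqrtr_ge0.
rewrite dist0 /euclidean_dist => dist_le0.
have sum_ge0 : 0 <= \sum_(i < n) (u 0 i - v 0 i) ^+ 2.
  by apply: sumr_ge0 => i _; exact: sqr_ge0.
have sum0 : \sum_(i < n) (u 0 i - v 0 i) ^+ 2 == 0.
  by rewrite eq_le sum_ge0 andbT -sqrtr_eq0 eq_le dist_le0 sqrtr_ge0.
move: sum0; rewrite psumr_eq0; last by move=> i _; exact: sqr_ge0.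
move=> /allP uv; apply/rowP => i.
have := uv i (mem_index_enum i).
by rewrite /= sqrf_eq0 subr_eq0 => /eqP.
Qed.

Section CriticalDatum.
Context {R : realType}.
Implicit Types (f : R -> R) (s g : R).

(** From density [s] to the maximal density the flux goes from [f s] to 0, so
    the intermediate value theorem provides a state with flux [g] there, and
    [g <> f s] keeps that state away from [s].  The outgoing case is the mirror
    image. *)
Lemma density_in_critical f s g :
  {within `[0, 1], continuous f} -> f 1 = 0 -> 0 < s < 1 -> 0 <= g < f s ->
  s < density_in f s s g /\ f (density_in f s s g) = g.
Proof.
move=> cf f1 /andP[s0 s1] /andP[g0 gs].
rewrite /density_in gt_eqF//.
have cfs : {within `[s, 1], continuous f}.
  apply: continuous_subspaceW cf => x /=; rewrite !in_itv /= => /andP[sx ->].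
  by rewrite (le_trans (ltW s0) sx).
have [|c] := IVT (v := g) (ltW s1) cfs.
  by rewrite f1 ge_min g0 orbT le_max (ltW gs).
rewrite in_itv /= => c01 fc.
have [/andP[sr _] fr] := xgetPex s
  (ex_intro (fun r => s <= r <= 1 /\ f r = g) c (conj c01 fc)).
split=> //; rewrite lt_neqAle sr andbT; apply/eqP => rs.
by move: gs; rewrite -fr -rs ltxx.
Qed.

Lemma density_out_critical f s g :
  {within `[0, 1], continuous f} -> f 0 = 0 -> 0 < s < 1 -> 0 <= g < f s ->
  density_out f s s g < s /\ f (density_out f s s g) = g.
Proof.
move=> cf f0 /andP[s0 s1] /andP[g0 gs].
rewrite /density_out gt_eqF//.
have cfs : {within `[0, s], continuous f}.
  apply: continuous_subspaceW cf => x /=; rewrite !in_itv /= => /andP[-> xs].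
  by rewrite (le_trans xs (ltW s1)).
have [|c] := IVT (v := g) (ltW s0) cfs.
  by rewrite f0 ge_min g0 le_max (ltW gs) orbT.
rewrite in_itv /= => c01 fc.
have [/andP[_ rs] fr] := xgetPex s
  (ex_intro (fun r => 0 <= r <= s /\ f r = g) c (conj c01 fc)).
split=> //; rewrite lt_neqAle rs andbT; apply/eqP => sr.
by move: gs; rewrite -fr sr ltxx.
Qed.

Lemma Gamma_arc_critical (n : nat) f s (i : 'I_n) :
  0 <= f s -> Gamma_arc f s (const_mx s) i = f s.
Proof.
move=> fs0; rewrite /Gamma_arc.
have supO l : sup (Omega f s (const_mx s : 'rV_(n + n)) l) = f s.
  rewrite /Omega /Omega_in /Omega_out mxE lexx.
  by case: fintype.split => _; rewrite sup_itvcc.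
by rewrite !supO minxx.
Qed.

Lemma Theta_lshift_le1 (n : nat) (theta : 'rV[R]_(n + n)) (i : 'I_n) :
  Theta theta -> theta 0 (lshift n i) <= 1.
Proof.
move=> [theta_gt0 <- _]; rewrite (bigD1 i)//= lerDl.
by apply: sumr_ge0 => j _; exact: ltW.
Qed.

Lemma Theta_n_gt0 (n : nat) (theta : 'rV[R]_(n + n)) :
  Theta theta -> (0 < n)%N.
Proof.
case: n theta => // theta [_ + _].
by rewrite big_ord0 => /eqP; rewrite eq_sym oner_eq0.
Qed.

(** A capacity below the maximal flux of a single arc makes the node the
    bottleneck, whatever the number of arcs; and since each coefficient is at
    most 1, no constraint of a single arc is active. *)
Lemma RS3_flux_critical (n : nat) f s (GammaJ : R) (theta : 'rV[R]_(n + n)) :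
  Theta theta -> 0 < GammaJ < f s ->
  RS3_flux f s GammaJ theta (const_mx s) =
    \row_(i < n) (GammaJ * theta 0 (lshift n i)).
Proof.
move=> Th /andP[G0 Gs].
have fs0 : 0 <= f s by rewrite ltW// (lt_trans G0).
have node : Gamma_node f s GammaJ (const_mx s : 'rV[R]_(n + n)) = GammaJ.
  rewrite /Gamma_node; under eq_bigr do rewrite Gamma_arc_critical//.
  rewrite sumr_const card_ord; apply/min_idPr/(le_trans (ltW Gs)).
  case: n theta Th => [theta /Theta_n_gt0//|n _ _].
  by rewrite mulrS lerDl mulrn_wge0.
rewrite /RS3_flux node; apply: orthogonal_projection_id; split=> [i|].
  rewrite !mxE Gamma_arc_critical//.
  have th1 := Theta_lshift_le1 _ _ i Th.
  have [/(_ (lshift n i)) th0 _ _] := Th.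
  rewrite mulr_ge0 ?(ltW G0) ?(ltW th0)//=.
  by rewrite (le_trans _ (ltW Gs))// ler_piMr// ltW.
under eq_bigr do rewrite mxE.
by rewrite -mulr_sumr; have [_ -> _] := Th; rewrite mulr1.
Qed.

Lemma RS3_critical_entropy_lt0 (n : nat) f s (GammaJ : R)
    (theta : 'rV[R]_(n + n)) :
  {within `[0, 1], continuous f} -> f 0 = 0 -> f 1 = 0 -> 0 < s < 1 ->
  Theta theta -> 0 < GammaJ < f s ->
  entropy_flux f (RS3 f s GammaJ theta (const_mx s)) s < 0.
Proof.
move=> cf f0 f1 s01 Th GJ; have [G0 Gs] := andP GJ.
set g := fun i : 'I_n => GammaJ * theta 0 (lshift n i).
have g_itv i : 0 <= g i < f s.
  have th1 := Theta_lshift_le1 _ _ i Th.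
  have [/(_ (lshift n i)) th0 _ _] := Th.
  rewrite /g mulr_ge0 ?(ltW G0) ?(ltW th0)//=.
  by rewrite (le_lt_trans _ Gs)// ler_piMr// ltW.
have -> : entropy_flux f (RS3 f s GammaJ theta (const_mx s)) s =
    \sum_(i < n) ((g i - f s) + (g i - f s)).
  rewrite /entropy_flux -sumrB; apply: eq_bigr => i _.
  have [rin fin] := density_in_critical _ _ _ cf f1 s01 (g_itv i).
  have [rout fout] := density_out_critical _ _ _ cf f0 s01 (g_itv i).
  rewrite !mxE (unsplitK (inl i)) (unsplitK (inr i)) RS3_flux_critical// !mxE.
  rewrite -/(g i) fin fout gtr0_sg ?subr_gt0// ltr0_sg ?subr_lt0//.
  by rewrite mul1r mulN1r opprK.
have neg i : (g i - f s) + (g i - f s) < 0.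
  by have /andP[_ gi] := g_itv i; lra.
rewrite (bigD1 (Ordinal (Theta_n_gt0 _ _ Th)))//= ltr_wnDr ?neg//.
by apply: sumr_le0 => i _; exact: ltW.
Qed.

End CriticalDatum.

(** * The quadratic flux *)

Section QuadraticFlux.
Context {R : realType}.

(** The flux is taken as the evaluation of a polynomial, so that all its
    iterated derivatives are again polynomial functions. *)
Definition quadratic_flux : R -> R := horner ('X * (1 - 'X)).

Lemma quadratic_fluxE (x : R) : quadratic_flux x = x * (1 - x).
Proof. by rewrite /quadratic_flux !hornerE. Qed.

Lemma smooth_horner (p : {poly R}) : smooth (horner p).
Proof.
move=> k x; suff -> : derive1n k (horner p) = horner p^`(k).
  exact: derivable_horner.
elim: k => [|k IHk]; first by rewrite derivn0.
by rewrite derive1nS IHk derivnS derivE.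
Qed.

Lemma concave_quadratic_flux : concave01 quadratic_flux.
Proof.
have concave (l x y : R) : 0 <= l -> l <= 1 ->
    - quadratic_flux (l * x + (1 - l) * y) <=
    l * - quadratic_flux x + (1 - l) * - quadratic_flux y.
  move=> l0 l1; rewrite !quadratic_fluxE -subr_ge0.
  (* The linear terms cancel; what is left is the convexity defect of [x ^+ 2]. *)
  rewrite [leRHS](_ : _ = l * (1 - l) * (x - y) ^+ 2); last by ring.
  by apply: mulr_ge0 (sqr_ge0 _); rewrite mulr_ge0 ?subr_ge0.
by move=> t x y _ _; apply: concave; [exact: ge0|exact: le1].
Qed.

Lemma flux_peak_quadratic : flux_peak quadratic_flux 2^-1.
Proof.
split=> [|x y|x y].
- by apply/andP; split; lra.
- rewrite !in_itv /= !quadratic_fluxE => /andP[_ xs] /andP[_ ys] xy.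
  by nra.
- rewrite !in_itv /= !quadratic_fluxE => /andP[sx _] /andP[sy _] xy.
  by nra.
Qed.

(** Between two distinct peaks, a function would be both increasing and
    decreasing. *)
Lemma flux_peak_unique (f : R -> R) (s t : R) :
  flux_peak f s -> flux_peak f t -> s = t.
Proof.
wlog st : s t / s <= t => [hw ps pt|].
  by have [/hw|/ltW /hw h] := leP s t; [exact|symmetry; exact: h].
move=> [/andP[s0 s1] _ dec] [/andP[t0 t1] inc _].
apply/eqP; rewrite eq_le st /= leNgt; apply/negP => lt_st.
pose x := s + (t - s) / 3; pose y := s + (t - s) / 3 * 2.
have [xs ys xt yt xy] : [/\ s < x, s < y, x < t, y < t & x < y].
  by rewrite /x /y; split; lra.
have fxy : f x < f y by apply: inc => //; rewrite in_itv /=; apply/andP; split; lra.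
have fyx : f y < f x by apply: dec => //; rewrite in_itv /=; apply/andP; split; lra.
by move: (lt_trans fxy fyx); rewrite ltxx.
Qed.

Lemma admissible_quadratic_flux : admissible_flux quadratic_flux 2^-1.
Proof.
split.
- exact/continuous_subspaceT/continuous_horner.
- exists [:: 1]; split=> //=; first by rewrite ltr01.
  by move=> i _; exists quadratic_flux => //; exact: smooth_horner.
- exact: concave_quadratic_flux.
- by rewrite !quadratic_fluxE; split; ring.
- split; first exact: flux_peak_quadratic.
  by move=> t; exact: flux_peak_unique flux_peak_quadratic.
Qed.

End QuadraticFlux.

Theorem proposition5p6 (R : realType) :
  exists (n : nat) (f : R -> R) (sigma GammaJ : R) (theta : 'rV[R]_(n + n)),
    [/\ (1 <= n)%N, admissible_flux f sigma, 0 < GammaJ & Theta theta] /\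
    (~ E1 f (RS3 f sigma GammaJ theta) /\ ~ E2 f sigma (RS3 f sigma GammaJ theta)).
Proof.
pose s : R := 2^-1; have adm : admissible_flux quadratic_flux s.
  exact: admissible_quadratic_flux.
have Th : Theta (const_mx 1 : 'rV[R]_(1 + 1)).
  by split=> [l||]; rewrite ?big_ord1 mxE.
exists 1%N, quadratic_flux, s, 8^-1, (const_mx 1).
have s01 : 0 < s < 1 by rewrite /s; apply/andP; split; lra.
have GJ : 0 < (8^-1 : R) < quadratic_flux s.
  by rewrite quadratic_fluxE /s; apply/andP; split; lra.
have [cf _ _ [f0 f1] _] := adm.
have neg := RS3_critical_entropy_lt0 _ _ _ _ _ cf f0 f1 s01 Th GJ.
have [s0 s1] := andP s01.
have dens : density (const_mx s : 'rV[R]_(1 + 1)).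
  by move=> l; rewrite mxE !ltW.
split; first by have [G0 _] := andP GJ.
have s_itv : 0 <= s <= 1 by rewrite !ltW.
by split=> [e1|e2]; [have := e1 _ dens s s_itv|have := e2 _ dens]; rewrite leNgt neg.
Qed.
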